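(* Let $G=SU_3$, let $K_1$ be a closed subgroup of $\mathbb{T}$ and let $K_2=0$ be the one element subgroup of $\mathbb{T}$, so that $K=K_1\times K_2\subset\mathbb{T}^2\simeq T$. Let $y_{(a)}^b$, $a,b\in\{1,2\}$, be real numbers, and let $\Theta$ be determined by $$(e^{i\phi},1)\mapsto\big[e^{i\phi y_{(1)}^1h_1}e^{i\phi y_{(1)}^2h_2},\;e^{i\phi y_{(2)}^1h_1}e^{i\phi y_{(2)}^2h_2}\big]\in(\mathcal{U}(T)\times\mathcal{U}(T))/\sim .$$ Then $\Theta$ defines a quantum orbifold if and only if the real numbers $y_{(a)}^b$ are of the form $$y_{(1)}^1=k_1^1+\frac{x}{3},\qquad y_{(1)}^2=k_1^2+\frac{2x}{3},\qquad y_{(2)}^1=k_2^1+\frac{2x}{3},\qquad y_{(2)}^2=k_2^2+\frac{x}{3}$$ for some $x\in\{0,1,2\}$ and $k_a^b\in\mathbb{Z}$ with $a,b\in\{1,2\}$.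
   Context: $q\in(0,1)$. $T$ is the maximal torus of $SU_3$, identified with $\mathbb{T}^2$ ($\mathbb{T}$ the circle group). $h_1=\mathrm{diag}(1,-1,0)$, $h_2=\mathrm{diag}(0,1,-1)$ are the generators of the Cartan subalgebra $\mathfrak{h}$. $U_q(\mathfrak{su}_3)$ is the Drinfeld–Jimbo Hopf algebra with generators $e_i,f_i,k_i^{\pm1}$ ($i=1,2$), with $k_ie_jk_i^{-1}=q^{a_{ij}/2}e_j$, $k_if_jk_i^{-1}=q^{-a_{ij}/2}f_j$, $[k_i,k_j]=0$, $[e_i,f_j]=\delta_{ij}\frac{k_i^2-k_i^{-2}}{q-q^{-1}}$ ($(a_{ij})$ the Cartan matrix of $\mathfrak{su}_3$), the quantum Serre relations, and $\triangle_q(k_i)=k_i\otimes k_i$, $\triangle_q(e_i)=e_i\otimes k_i+k_i^{-1}\otimes e_i$, $\triangle_q(f_i)=f_i\otimes k_i+k_i^{-1}\otimes f_i$, $S_q(k_i)=k_i^{-1}$, $S_q(e_i)=-qe_i$, $S_q(f_i)=-q^{-1}f_i$. For each dominant integral weight $\lambda\in P_+$, $(\varrho_{\lambda q},M_{\lambda,q})$ is the irreducible highest weight representation, a direct sum of weight spaces; a vector $v$ has weight $\mu$ if $k_iv=q^{\mu(h_i)/2}v$. $\mathcal{U}(SU_{3q})=\prod_{\lambda\in P_+}\mathcal{B}(M_{\lambda,q})$. The element $h_i$ acts on weight-$\mu$ vectors by $\mu(h_i)$, and $\mathcal{U}(T)\subset\mathcal{U}(SU_{3q})$, the image of $T$,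 is the group of the elements $e^{i(y_1h_1+y_2h_2)}$, $y_1,y_2\in\mathbb{R}$. $\mathbb{C}[SU_{3q}]=\bigoplus_{\lambda\in P_+}M_{\lambda,q}^*\otimes M_{\lambda,q}$ is viewed as a space of functionals on $\mathcal{U}(SU_{3q})$ by $(u^*\otimes u)(x)=u^*(\varrho_{\lambda q}(x)u)$. For $\sigma\in\mathcal{U}(T)$ the left and right actions on $\mathbb{C}[SU_{3q}]$ are $(l_q(\sigma)t)(y)=t(\sigma y)$ and $(\partial_q(\sigma)t)(y)=t(y\sigma)$. The equivalence relation $\sim$ on $\mathcal{U}(T)\times\mathcal{U}(T)$ is $(\sigma_1,\sigma_2)\sim(\sigma_1\mu,\mu^{-1}\sigma_2)$ for $\mu\in\mathcal{U}(T)\cap Z\mathcal{U}(SU_{3q})$ ($Z$ denotes the center). A quantum orbifold is an action $\Theta$ of the group $K$ on $\mathbb{C}[SU_{3q}]$ of the form $\Theta(\sigma,t)=l_q(\sigma_{(1)})\partial_q(\sigma_{(2)})t$, where $\sigma\mapsto[\sigma_{(1)},\sigma_{(2)}]$ is a map $K\to(\mathcal{U}(T)\times\mathcal{U}(T))/\sim$. In the claim, the displayed assignment is considered for all $\phi\in\mathbb{R}$ with $e^{i\phi}\in K_1$; ''$\Theta$ defines a quantum orbifold'' includes the requirement that the assignment be well defined on $K_1\times\{1\}$, i.e. $2\pi$-periodic in $\phi$. *)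

(* Defs.v *)
From HB Require Import structures.
From mathcomp Require Import all_boot all_order all_algebra.
From mathcomp Require Import complex.
From mathcomp Require Import all_classical all_reals all_analysis.

Set Implicit Arguments.
Unset Strict Implicit.
Unset Printing Implicit Defensive.

Import Order.TTheory GRing.Theory Num.Theory.
Import numFieldNormedType.Exports.

Local Open Scope classical_set_scope.
Local Open Scope ring_scope.
Local Open Scope complex_scope.

Section Circle.
Variable R : realType.

Definition expi (t : R) : R[i] := cos t +i* sin t.

(* [R[i]^o] is [R[i]] with its norm topology. *)
Record closed_circle_subgroup (K1 : set R[i]) : Prop := {
  circle_norm : forall z, K1 z -> `|z| = 1;
  circle_1 : K1 1;
  circle_M : forall z w, K1 z -> K1 w -> K1 (z * w);
  circle_V : forall z, K1 z -> K1 z^-1;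
  circle_closed : closed (K1 : set R[i]^o) }.

End Circle.

(* The simple roots are indexed by ['I_2]; a weight mu is represented by the
   pair of its values on the coroots h_1 = diag(1,-1,0), h_2 = diag(0,1,-1),
   and an element of P_+ by the pair of naturals lambda(h_1), lambda(h_2). *)
Definition weight (R : realType) := 'I_2 -> R.
Definition dominant := {ffun 'I_2 -> nat}.
Definition weight_of (R : realType) (l : dominant) : weight R :=
  fun i => (l i)%:R.

(* a_ij = alpha_j(h_i) *)
Definition cartan (R : realType) (i j : 'I_2) : R := if i == j then 2 else -1.

Section QuantumGroup.
Variables (R : realType) (q : R).

(* A finite-dimensional representation of the algebra U_q(su_3), presented by
   its generators and relations: operators e_i, f_i, k_i, k_i^-1 subject to
   the defining relations. *)
Record Uq_rep := {
  rep_space :> vectType R[i];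
  rep_e : 'I_2 -> 'End(rep_space);
  rep_f : 'I_2 -> 'End(rep_space);
  rep_k : 'I_2 -> 'End(rep_space);
  rep_kV : 'I_2 -> 'End(rep_space);
  rep_kKV : forall i, (rep_k i \o rep_kV i)%VF = \1%VF;
  rep_kVK : forall i, (rep_kV i \o rep_k i)%VF = \1%VF;
  rep_kk : forall i j, (rep_k i \o rep_k j)%VF = (rep_k j \o rep_k i)%VF;
  rep_ke : forall i j, (rep_k i \o rep_e j \o rep_kV i)%VF
                       = (q `^ (cartan R i j / 2))%:C *: rep_e j;
  rep_kf : forall i j, (rep_k i \o rep_f j \o rep_kV i)%VF
                       = (q `^ (- (cartan R i j / 2)))%:C *: rep_f j;
  rep_ef : forall i j,
    (rep_e i \o rep_f j)%VF - (rep_f j \o rep_e i)%VF =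
    if i == j then
      ((q - q^-1)^-1)%:C *:
        ((rep_k i \o rep_k i)%VF - (rep_kV i \o rep_kV i)%VF)
    else 0;
  rep_serre_e : forall i j, i != j ->
    (rep_e i \o rep_e i \o rep_e j)%VF
    - (q + q^-1)%:C *: (rep_e i \o rep_e j \o rep_e i)%VF
    + (rep_e j \o rep_e i \o rep_e i)%VF = 0;
  rep_serre_f : forall i j, i != j ->
    (rep_f i \o rep_f i \o rep_f j)%VF
    - (q + q^-1)%:C *: (rep_f i \o rep_f j \o rep_f i)%VF
    + (rep_f j \o rep_f i \o rep_f i)%VF = 0 }.

Definition has_weight (V : Uq_rep) (mu : weight R) (v : V) : Prop :=
  forall i, rep_k V i v = (q `^ (mu i / 2))%:C *: v.

Definition invariant_subspace (V : Uq_rep) (U : {vspace V}) : Prop :=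
  forall i, [/\ (rep_e V i @: U <= U)%VS, (rep_f V i @: U <= U)%VS,
                (rep_k V i @: U <= U)%VS & (rep_kV V i @: U <= U)%VS].

Definition irreducible_rep (V : Uq_rep) : Prop :=
  (fullv : {vspace V}) != 0%VS /\
  forall U : {vspace V}, invariant_subspace U -> U = 0%VS \/ U = fullv.

Definition highest_weight_vector (V : Uq_rep) (mu : weight R) (v : V) : Prop :=
  [/\ v != 0, has_weight mu v & forall i, rep_e V i v = 0].

(* A model of M_{l,q}, which is unique up to isomorphism. *)
Record hw_irrep (l : dominant) := {
  irrep_rep :> Uq_rep;
  irrep_irreducible : irreducible_rep irrep_rep;
  irrep_highest : exists v : irrep_rep,
    highest_weight_vector (weight_of R l) v }.

End QuantumGroup.

Section UAlgebra.
Variables (R : realType) (q : R) (M : forall l : dominant, hw_irrep q l).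

(* The algebra prod_l B(M_l). *)
Definition UG := forall l : dominant, 'End(M l).

Definition U1 : UG := fun l => \1%VF.
Definition Umul (x y : UG) : UG := fun l => (x l \o y l)%VF.

(* The inverse of x when x is invertible. *)
Definition Uinv (x : UG) : UG := fun l => (x l)^-1%VF.

Definition central (x : UG) : Prop := forall y, Umul x y = Umul y x.

Definition pairing (y : 'I_2 -> R) (mu : weight R) : R := \sum_i y i * mu i.

Definition acts_as_exp (y : 'I_2 -> R) (l : dominant) (x : 'End(M l)) : Prop :=
  forall (mu : weight R) (v : M l),
    has_weight mu v -> x v = expi (pairing y mu) *: v.

(* e^{i(y_1 h_1 + y_2 h_2)}, i.e. the operator acting on the vectors of weight
   mu by e^{i(y_1 mu(h_1) + y_2 mu(h_2))}.  It exists and is unique when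
   0 < q < 1: see [UexpP] and [Uexp_unique] below. *)
Definition Uexp (y : 'I_2 -> R) : UG :=
  fun l => xget \1%VF [set x : 'End(M l) | acts_as_exp y x].

(* e^{i s h_b} *)
Definition Uexph (b : 'I_2) (s : R) : UG :=
  Uexp (fun j => if j == b then s else 0).

Definition UT : set UG := [set Uexp y | y in [set: 'I_2 -> R]].

Definition UT_equiv (s t : UG * UG) : Prop :=
  exists mu : UG, [/\ UT mu, central mu,
    t.1 = Umul s.1 mu & t.2 = Umul (Uinv mu) s.2].

(* The class [s1, s2] in (U(T) x U(T))/~, as a set of pairs. *)
Definition UT_class (s1 s2 : UG) : set (UG * UG) :=
  [set t | [/\ UT t.1, UT t.2 & UT_equiv (s1, s2) t]].

Definition UT_quotient : set (set (UG * UG)) :=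
  [set c | exists s1 s2 : UG, [/\ UT s1, UT s2 & c = UT_class s1 s2]].

Definition functional := UG -> R[i].

Definition matrix_coef (l : dominant) (us : 'Hom(M l, R[i]^o)) (u : M l) :
  functional := fun x => us (x l u).

(* C[SU_{3q}]: the finite sums of matrix coefficients. *)
Definition CG : set functional :=
  [set t | exists s : seq {l : dominant & ('Hom(M l, R[i]^o) * M l)%type},
     t = fun x => \sum_(c <- s) matrix_coef (tagged c).1 (tagged c).2 x].

Definition lq (s : UG) (t : functional) : functional := fun y => t (Umul s y).
Definition dq (s : UG) (t : functional) : functional := fun y => t (Umul y s).

(* A linear action on C[SU_{3q}] of a subgroup K of the torus T x T, whose
   group law is the componentwise multiplication of [R[i] * R[i]]. *)
Record action_on_CG (K : set (R[i] * R[i]))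
    (Theta : R[i] * R[i] -> functional -> functional) : Prop := {
  action_stable : forall s t, K s -> CG t -> CG (Theta s t);
  action_linear : forall s (a : R[i]) t t', K s -> CG t -> CG t' ->
    Theta s (fun y => a * t y + t' y)
    = fun y => a * Theta s t y + Theta s t' y;
  action_1 : forall t, CG t -> Theta 1 t = t;
  action_M : forall s s' t, K s -> K s' -> CG t ->
    Theta (s * s') t = Theta s (Theta s' t) }.

(* Theta is a quantum orbifold, of the form
   Theta(s, t) = l_q(s_(1)) d_q(s_(2)) t with s |-> [s_(1), s_(2)] the map F. *)
Record quantum_orbifold (K : set (R[i] * R[i]))
    (F : R[i] * R[i] -> set (UG * UG))
    (Theta : R[i] * R[i] -> functional -> functional) : Prop := {
  orbifold_map : forall s, K s -> UT_quotient (F s);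
  orbifold_form : forall s t s1 s2, K s -> CG t -> F s (s1, s2) ->
    Theta s t = lq s1 (dq s2 t);
  orbifold_action : action_on_CG K Theta }.

(* The class assigned to the parameter phi. *)
Definition assigned_class (y : 'I_2 -> 'I_2 -> R) (phi : R) :
    set (UG * UG) :=
  UT_class
    (Umul (Uexph 0 (phi * y 0 0)) (Uexph 1 (phi * y 0 1)))
    (Umul (Uexph 0 (phi * y 1 0)) (Uexph 1 (phi * y 1 1))).

(* The assignment (e^{i phi}, 1) |-> [.., ..] is well defined on K1 x {1} and
   the resulting Theta is a quantum orbifold. *)
Definition defines_quantum_orbifold (K1 : set R[i]) (y : 'I_2 -> 'I_2 -> R) :
    Prop :=
  exists F Theta,
    (forall phi, K1 (expi phi) -> F (expi phi, 1) = assigned_class y phi) /\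
    quantum_orbifold (K1 `*` [set 1]) F Theta.

End UAlgebra.

Section UexpSpec.
Variables (R : realType) (q : R).
Hypothesis hq : 0 < q < 1.

Let q_gt0 : 0 < q. Proof. by case/andP: hq. Qed.
Let q_neq0 : q != 0. Proof. by rewrite gt_eqF. Qed.

Lemma qpowD (r s : R) : (q `^ (r + s))%:C = (q `^ r)%:C * (q `^ s)%:C.
Proof. by rewrite powRD ?q_neq0 ?implybT // rmorphM. Qed.

Lemma qpow_neq0 (r : R) : (q `^ r)%:C != 0.
Proof. by rewrite fmorph_eq0 powR_eq0 (negPf q_neq0). Qed.

Lemma qpow_inj (r s : R) : (q `^ r)%:C = (q `^ s)%:C -> r = s.
Proof.
move=> /(congr1 (@complex.Re R)) /= /(congr1 (@ln R)).
have lnq : ln q != 0 by rewrite lt_eqF // ln_lt0.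
by rewrite !ln_powR => /(mulIf lnq).
Qed.

Lemma endZ (V : vectType R[i]) (g : 'End(V)) (c : R[i]) (v : V) :
  g (c *: v) = c *: g v.
Proof. exact: linearZ. Qed.

Section Rep.
Variable V : Uq_rep q.

Lemma has_weightZ mu (c : R[i]) (v : V) :
  has_weight mu v -> has_weight mu (c *: v).
Proof. by move=> hv i; rewrite endZ hv !scalerA mulrC. Qed.

Lemma has_weight_kV mu (v : V) i :
  has_weight mu v -> rep_kV V i v = (q `^ (- (mu i / 2)))%:C *: v.
Proof.
move=> hv; have h : rep_kV V i (rep_k V i v) = v.
  by have /lfunP/(_ v) := rep_kVK V i; rewrite !lfunE.
by rewrite -{2}h hv endZ scalerA -qpowD addNr powRr0 scale1r.
Qed.

Lemma has_weight_shift mu (v : V) (a : R) (g : 'End(V)) i :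
    (rep_k V i \o g \o rep_kV V i)%VF = (q `^ (a / 2))%:C *: g ->
    has_weight mu v ->
  rep_k V i (g v) = (q `^ ((mu i + a) / 2))%:C *: g v.
Proof.
move=> /lfunP/(_ (rep_k V i v)); rewrite !lfunE /= => + hv.
have -> : rep_kV V i (rep_k V i v) = v.
  by have /lfunP/(_ v) := rep_kVK V i; rewrite !lfunE.
by rewrite lfunE /= => ->; rewrite hv endZ scalerA -qpowD addrC mulrDl.
Qed.

Lemma has_weight_e mu (v : V) j : has_weight mu v ->
  has_weight (fun i => mu i + cartan R i j) (rep_e V j v).
Proof. by move=> hv i; apply: has_weight_shift => //; apply: rep_ke. Qed.

Lemma has_weight_f mu (v : V) j : has_weight mu v ->
  has_weight (fun i => mu i - cartan R i j) (rep_f V j v).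
Proof.
move=> hv i; apply: has_weight_shift => //.
by rewrite mulNr; apply: rep_kf.
Qed.

Lemma weight_basis (l : weight R) : irreducible_rep V ->
    (exists v, highest_weight_vector (V := V) l v) ->
  exists X : seq V, basis_of fullv X /\
    forall v, v \in X -> exists mu, has_weight mu v.
Proof.
move=> [_ irrV] [v0 [v0N0 wv0 _]].
pose P n := `[< exists X : seq V, [/\ free X, size X = n &
   forall v, v \in X -> exists mu, has_weight mu v] >].
have exP : exists n, P n by exists 0%N; apply/asboolP; exists [::];
  split=> //; exact: nil_free.
have ubP n : P n -> (n <= \dim (fullv : {vspace V}))%N.
  case/asboolP => X [fX <- _].
  by rewrite -(eqP fX) dimvS ?subvf.
case: (ex_maxnP exP ubP) => n /asboolP[X [fX sX wX]] nmax.
have inX mu v : has_weight mu v -> v \in <<X>>%VS.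
  move=> hv; apply/negPn/negP => vX.
  have : P n.+1.
    apply/asboolP; exists (v :: X); split => /=; last 2 first.
    - by rewrite sX.
    - by move=> u; rewrite inE => /orP[/eqP ->|/wX //]; exists mu.
    by rewrite free_cons vX.
  by move/nmax; rewrite ltnn.
have [|X0|XT] := irrV <<X>>%VS.
- move=> i; split; rewrite limg_span; apply/span_subvP => _ /mapP[v /wX[mu hv] ->].
  + exact: inX (has_weight_e i hv).
  + exact: inX (has_weight_f i hv).
  + by rewrite hv memvZ // (inX mu).
  + by rewrite (has_weight_kV _ hv) memvZ // (inX mu).
- by move: (inX _ _ wv0); rewrite X0 memv0 (negPf v0N0).
- by exists X; split=> //; rewrite basisEfree fX -XT subvv /= XT -(eqP fX) -XT.
Qed.

End Rep.

Variable M : forall l : dominant, hw_irrep q l.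

Lemma acts_as_exp_exists (y : 'I_2 -> R) (l : dominant) :
  exists x : 'End(M l), acts_as_exp y x.
Proof.
have [X [bX wX]] := weight_basis (irrep_irreducible (M l)) (irrep_highest (M l)).
pose w v : weight R := xget (fun=> 0) [set mu | has_weight (V := M l) mu v].
have wE v : v \in X -> has_weight (w v) v.
  by move=> /wX[mu hmu]; apply: (@xgetPex _ (fun=> 0) [set mu | has_weight mu v]); exists mu.
pose fX := [seq expi (pairing y (w v)) *: v | v <- X].
have [f /(_ (basis_free bX) (size_map _ _)) fE] := linear_of_free X fX.
have {}fE v : v \in X -> f v = expi (pairing y (w v)) *: v.
  by move: v; apply/eq_in_map.
exists (linfun f) => mu v hv; rewrite lfunE /=.
have vX : v \in <<in_tuple X>>%VS by rewrite (span_basis bX) memvf.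
have vE := coord_span vX.
have fXt : free (in_tuple X) by rewrite (basis_free bX).
have Xi (i : 'I_(size X)) : (in_tuple X)`_i \in X by rewrite mem_nth.
rewrite {1}vE {2}vE linear_sum scaler_sumr; apply: eq_bigr => i _.
rewrite linearZ /= fE // !scalerA [in RHS]mulrC.
have [->|cN0] := eqVneq (coord (in_tuple X) i v) 0; first by rewrite !mul0r.
congr (_ * expi _ *: _); apply: eq_bigr => j _; congr (_ * _).
have := hv j; rewrite [in LHS]vE linear_sum /= => /(congr1 (coord (in_tuple X) i)).
rewrite !linearE /=.
under eq_bigr => k _ do rewrite endZ wE // scalerA.
rewrite coord_sum_free // => /esym; rewrite mulrC => /(mulfI cN0)/qpow_inj.
by move=> h; apply/esym; move: h; apply: mulIf; rewrite invr_eq0 pnatr_eq0.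
Qed.

Lemma UexpP (y : 'I_2 -> R) (l : dominant) : acts_as_exp y (Uexp M y l).
Proof. exact: xgetPex (acts_as_exp_exists y l). Qed.

Lemma Uexp_unique (y : 'I_2 -> R) (l : dominant) (x : 'End(M l)) :
  acts_as_exp y x -> x = Uexp M y l.
Proof.
move=> xP.
have [X [bX wX]] := weight_basis (irrep_irreducible (M l)) (irrep_highest (M l)).
apply/lfunP => v; have vX : v \in <<in_tuple X>>%VS.
  by rewrite (span_basis bX) memvf.
rewrite (coord_span vX) !linear_sum; apply: eq_bigr => i _; rewrite [LHS]linearZ [RHS]linearZ /=.
have /wX[mu hmu] : (in_tuple X)`_i \in X by rewrite mem_nth.
by rewrite (xP _ _ hmu) (UexpP _ hmu).
Qed.

End UexpSpec.

(* Main.v *)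
Require Import Defs.
From mathcomp Require Import all_boot all_order all_algebra.
From mathcomp Require Import complex.
From mathcomp Require Import all_classical all_reals all_analysis.
From mathcomp Require Import ring lra.

(** Everything reduces to one turn of the circle: the assignment is
    [2 pi]-periodic exactly when its classes at [phi = 0] and [phi = 2 pi] agree, i.e. when for
    some central [mu] in the torus
      [e^{2 pi i (y_00 h_1 + y_01 h_2)} = mu^-1] and
      [e^{2 pi i (y_10 h_1 + y_11 h_2)} = mu].
    Write [mu = e^{2 pi i (w_0 h_1 + w_1 h_2)}].

    Centrality of [mu] means that [w] pairs to integers with the simple roots,
    [2 w_0 - w_1] and [2 w_1 - w_0] in Z ([central_Uexp]).  In one direction,
    lowering the highest weight vector of weight (1,1) by a simple root gives a
    nonzero vector ([lowering_neq0]), and a scalar must take the same value on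
    both.  In the other, such a [mu] commutes with all the generators, so by
    Schur's lemma it is a scalar on every [M l] ([Uexp_scalar]).

    An element [e^{2 pi i (w_0 h_1 + w_1 h_2)}] is trivial if and only if
    [w_0] and [w_1] are integers ([Uexp_eq1]): highest weight vectors of the two
    fundamental weights detect the coordinates of [w], and for integral [w]
    the scalar given by Schur's lemma is the value at the highest weight, 1.

    Eliminating [w], periodicity amounts to
      [2 y_00 - y_01], [2 y_01 - y_00], [y_00 + y_10], [y_01 + y_11] in Z
    ([periodicity_condition]).  The first two say that [(y_00, y_01)] lies in
    the coweight lattice, which contains the coroot lattice [Z^2] with index 3
    and quotient generated by [(1/3, 2/3)]; this is where [x] comes from
    ([periodicity_conditionP]).

    Conversely a periodic assignment always gives an action
    ([orbifold_of_periodicity]): two-sided translation does not depend on the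
    representative of a class because the ambiguity is central
    ([UT_class_translation]), and it is multiplicative in the angle because
    the torus is commutative. *)

Set Implicit Arguments.
Unset Strict Implicit.
Unset Printing Implicit Defensive.

Import Order.TTheory GRing.Theory Num.Theory.

Local Open Scope classical_set_scope.
Local Open Scope ring_scope.
Local Open Scope complex_scope.

(** * The exponential parametrization of the circle *)

Section CircleParametrization.
Variable R : realType.
Implicit Types s t u : R.

Lemma expi0 : expi (0 : R) = 1.
Proof. by rewrite /expi cos0 sin0. Qed.

Lemma expiD s t : expi (s + t) = expi s * expi t.
Proof.
apply/eqP; rewrite eq_complex /= cosD sinD eqxx /=.
by apply/eqP; ring.
Qed.

Lemma expi_neq0 t : expi t != 0.
Proof.
apply/eqP => t0; have := expiD t (- t).
by rewrite subrr expi0 t0 mul0r => /eqP; rewrite oner_eq0.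
Qed.

Lemma expi_fixes (V : lmodType R[i]) s (v : V) :
  v != 0 -> expi s *: v = v -> expi s = 1.
Proof.
move=> v0 /eqP; rewrite -subr_eq0 -{2}(scale1r v) -scalerBl scaler_eq0.
by rewrite (negPf v0) orbF subr_eq0 => /eqP.
Qed.

(** A half-angle argument: [cos t = 1] forces [sin (t / 2) = 0], but [sin] is
    positive inside [(0, pi)]. *)
Lemma cos_eq1_fundamental t : 0 <= t < pi *+ 2 -> cos t = 1 -> t = 0.
Proof.
case/andP=> t0 tpi ct.
have th : t = (t / 2) *+ 2 by rewrite -mulr_natr divfK.
apply/eqP/negPn/negP => tN0.
have : 0 < sin (t / 2).
  apply: sin_gt0_pi; apply/andP; split.
    by rewrite divr_gt0 // lt_neqAle eq_sym tN0.
  by rewrite ltr_pdivrMr // mulr_natr.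
move: ct; rewrite {1}th cos_mulr2n cos2sin2 => ct.
have : sin (t / 2) ^+ 2 = 0 by move: ct; rewrite -mulr_natr; lra.
by move/eqP; rewrite sqrf_eq0 => /eqP ->; rewrite ltxx.
Qed.

Lemma expi_period (m : int) : expi (pi *+ 2 * m%:~R : R) = 1.
Proof.
have nat_case (n : nat) : expi (pi *+ 2 * n%:R : R) = 1.
  elim: n => [|n IH]; first by rewrite mulr0 expi0.
  rewrite -natr1 mulrDr expiD IH mulr1 mul1r.
  by rewrite /expi cos2pi sin2pi.
case: m => n; first exact: nat_case.
rewrite NegzE; apply: (mulfI (expi_neq0 (pi *+ 2 * n.+1%:R))).
by rewrite -expiD rmorphN mulrN subrr expi0 nat_case mulr1.
Qed.

Lemma expi_eq1 u : expi (pi *+ 2 * u) = 1 <-> u \is a Num.int.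
Proof.
split=> [h|/intrP[m ->]]; last exact: expi_period.
have pi2 : 0 < pi *+ 2 :> R by rewrite pmulrn_lgt0 // pi_gt0.
have [fl ltf] : (Num.floor u)%:~R <= u /\ u < (Num.floor u)%:~R + 1.
  by split; [exact: floor_le | have := floorD1_gt u; rewrite intrD].
have : pi *+ 2 * (u - (Num.floor u)%:~R) = 0.
  apply: cos_eq1_fundamental.
    apply/andP; split; first by rewrite mulr_ge0 ?subr_ge0 // ltW.
    by rewrite -[ltRHS]mulr1 ltr_pM2l // ltrBlDl.
  have : expi (pi *+ 2 * (u - (Num.floor u)%:~R)) = 1.
    by rewrite mulrBr -mulrN -rmorphN expiD h expi_period mulr1.
  by case.
by move/eqP; rewrite mulf_eq0 gt_eqF //= subr_eq0 => /eqP ->; rewrite intr_int.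
Qed.

Lemma expi_surj (z : R[i]) : `|z| = 1 -> exists t, expi t = z.
Proof.
case: z => a b; rewrite normc_def /= => -[] n1.
have n2 : a ^+ 2 + b ^+ 2 = 1.
  by rewrite -[LHS]sqr_sqrtr ?addr_ge0 ?sqr_ge0 // n1 expr1n.
have a1 : -1 <= a <= 1.
  by apply/andP; split; nra.
have sb : Num.sqrt (1 - a ^+ 2) = `|b| by rewrite -n2 addrC addKr sqrtr_sqr.
have [b0|b0] := leP 0 b.
  by exists (acos a); rewrite /expi acosK ?in_itv //= sin_acos // sb ger0_norm.
exists (- acos a); rewrite /expi cosN sinN acosK ?in_itv //= sin_acos // sb.
by rewrite ltr0_norm // opprK.
Qed.

End CircleParametrization.

(** * Weights and the pairing *)

Lemma ord2P (P : 'I_2 -> Prop) : P 0 -> P 1 -> forall j, P j.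
Proof.
move=> P0 P1 [[|[|//]] ltj].
  by have -> : Ordinal ltj = 0 by apply/val_inj.
by have -> : Ordinal ltj = 1 by apply/val_inj.
Qed.

Definition simple_root (R : realType) (j : 'I_2) : weight R :=
  fun i => cartan R i j.

Section Pairing.
Variable R : realType.
Implicit Types (a b : 'I_2 -> R) (mu nu : weight R).

Lemma pairingE a mu : pairing a mu = a 0 * mu 0 + a 1 * mu 1.
Proof.
rewrite /pairing big_ord_recl big_ord1.
by congr (_ + a _ * mu _); apply/val_inj.
Qed.

Lemma pairing0l mu : pairing (fun=> 0) mu = 0.
Proof. by rewrite pairingE !mul0r addr0. Qed.

Lemma pairingDl a b mu :
  pairing (fun i => a i + b i) mu = pairing a mu + pairing b mu.
Proof. by rewrite !pairingE; ring. Qed.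

Lemma pairingNl a mu : pairing (fun i => - a i) mu = - pairing a mu.
Proof. by rewrite !pairingE; ring. Qed.

Lemma pairingZl c a mu : pairing (fun i => c * a i) mu = c * pairing a mu.
Proof. by rewrite !pairingE; ring. Qed.

Lemma pairingDr a mu nu :
  pairing a (fun i => mu i + nu i) = pairing a mu + pairing a nu.
Proof. by rewrite !pairingE; ring. Qed.

Lemma pairingNr a nu : pairing a (fun i => - nu i) = - pairing a nu.
Proof. by rewrite !pairingE; ring. Qed.

Lemma pairing_simple_root0 a : pairing a (simple_root R 0) = 2 * a 0 - a 1.
Proof. by rewrite pairingE /simple_root /cartan /=; ring. Qed.

Lemma pairing_simple_root1 a : pairing a (simple_root R 1) = 2 * a 1 - a 0.
Proof. by rewrite pairingE /simple_root /cartan /=; ring. Qed.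

End Pairing.

(** * Two facts on highest weight representations *)

Section Representation.
Variables (R : realType) (q : R).
Hypothesis hq : 0 < q < 1.
Variable V : Uq_rep q.

(** If [f_j v] vanished, then [e_j f_j - f_j e_j] would kill [v]; but it scales
    the highest weight vector [v] by the quantum integer
    [(q^(mu_j) - q^(-mu_j)) / (q - q^-1)], nonzero since [0 < q < 1]
    makes [q^r] determine [r]. *)
Lemma lowering_neq0 (mu : weight R) (v : V) j :
  highest_weight_vector mu v -> mu j != 0 -> rep_f V j v != 0.
Proof.
move=> [v0 wv ev] muj; apply/eqP => fv.
have /lfunP/(_ v) := rep_ef V j j; rewrite eqxx.
rewrite !(add_lfunE, opp_lfunE, scale_lfunE, comp_lfunE) /= fv ev.
rewrite !linear0 addr0 wv !(has_weight_kV hq j wv) !endZ.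
rewrite wv (has_weight_kV hq j wv) !scalerA -!(qpowD hq) -scalerBl scalerA.
move/esym/eqP; rewrite scaler_eq0 (negPf v0) orbF mulf_eq0.
have [q0 q1] := andP hq.
have qq : q - q^-1 != 0.
  rewrite subr_eq0; apply/eqP => qE; have : q * q = 1.
    by rewrite {2}qE divff // gt_eqF.
  by nra.
rewrite fmorph_eq0 invr_eq0 (negPf qq) /= subr_eq0 => /eqP/(qpow_inj hq) h.
by case/negP: muj; apply/eqP; lra.
Qed.

(** Schur's lemma for an operator with a known eigenvector: its eigenspace is a
    nonzero invariant subspace, hence everything. *)
Lemma eigenspace_eq_fullv (T : 'End(V)) (c : R[i]) (v : V) :
    irreducible_rep V ->
    (forall j, [/\ (rep_e V j \o T = T \o rep_e V j)%VF,
                   (rep_f V j \o T = T \o rep_f V j)%VF,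
                   (rep_k V j \o T = T \o rep_k V j)%VF &
                   (rep_kV V j \o T = T \o rep_kV V j)%VF]) ->
  v != 0 -> T v = c *: v -> forall u, T u = c *: u.
Proof.
move=> [_ irrV] comT v0 Tv.
pose U := lker (T - c *: \1)%VF.
have inU u : (u \in U) = (T u == c *: u).
  by rewrite memv_ker add_lfunE opp_lfunE scale_lfunE id_lfunE subr_eq0.
have stable (g : 'End(V)) : (g \o T = T \o g)%VF -> (g @: U <= U)%VS.
  move=> /lfunP gT; apply/subvP => _ /memv_imgP[u uU ->].
  move: uU; rewrite !inU => /eqP Tu.
  by have := gT u; rewrite !lfunE /= Tu endZ => <-.
have [j|U0|UT] := irrV U.
- by have [? ? ? ?] := comT j; split; exact: stable.
- have : v \in U by rewrite inU Tv.
  by rewrite U0 memv0 (negPf v0).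
- by move=> u; apply/eqP; rewrite -inU UT memvf.
Qed.

End Representation.

(** * The torus inside the completed algebra *)

Section Torus.
Variables (R : realType) (q : R).
Hypothesis hq : 0 < q < 1.
Variable M : forall l : dominant, hw_irrep q l.
Implicit Types (a b w : 'I_2 -> R) (l : dominant) (s t x : UG M).

Lemma eq_on_weight_vectors l (S T : 'End(M l)) :
    (forall mu (v : M l), has_weight mu v -> S v = T v) -> S = T.
Proof.
move=> ST; have [X [bX wX]] :=
  weight_basis hq (irrep_irreducible (M l)) (irrep_highest (M l)).
apply/lfunP => v; have vX : v \in <<in_tuple X>>%VS.
  by rewrite (span_basis bX) memvf.
rewrite (coord_span vX) !linear_sum; apply: eq_bigr => i _.
rewrite [LHS]linearZ [RHS]linearZ /=.
have /wX[mu hmu] : (in_tuple X)`_i \in X by rewrite mem_nth.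
by rewrite (ST _ _ hmu).
Qed.

Lemma eq_Uexp a b : (forall i, a i = b i) -> Uexp M a = Uexp M b.
Proof. by move=> ab; congr Uexp; apply/funext. Qed.

Lemma UmulA s t x : Umul s (Umul t x) = Umul (Umul s t) x.
Proof.
by apply/functional_extensionality_dep => l; rewrite /Umul comp_lfunA.
Qed.

Lemma Umul1 x : Umul x (U1 M) = x.
Proof.
by apply/functional_extensionality_dep => l; rewrite /Umul comp_lfun1r.
Qed.

Lemma mul1U x : Umul (U1 M) x = x.
Proof.
by apply/functional_extensionality_dep => l; rewrite /Umul comp_lfun1l.
Qed.

Lemma Uexp0 : Uexp M (fun=> 0) = U1 M.
Proof.
apply/functional_extensionality_dep => l; apply/esym/(Uexp_unique hq) => mu v _.
by rewrite pairing0l expi0 scale1r id_lfunE.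
Qed.

Lemma UexpD a b : Umul (Uexp M a) (Uexp M b) = Uexp M (fun i => a i + b i).
Proof.
apply/functional_extensionality_dep => l; apply/(Uexp_unique hq) => mu v wv.
rewrite comp_lfunE /= (UexpP hq b wv) endZ (UexpP hq a wv) scalerA.
by rewrite pairingDl expiD mulrC.
Qed.

Lemma UexpV a : Uinv (Uexp M a) = Uexp M (fun i => - a i).
Proof.
apply/functional_extensionality_dep => l; rewrite /Uinv.
have invl b : (Uexp M (fun i => - b i)%R l \o Uexp M b l)%VF = \1%VF.
  have := UexpD (fun i => - b i) b.
  rewrite (@eq_Uexp (fun i => - b i + b i) (fun=> 0)) => [|i]; last first.
    by rewrite addNr.
  by rewrite Uexp0 => /(congr1 (fun z : UG M => z l)).
have ker0 : lker (Uexp M a l) == 0%VS.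
  apply/lker0P => u v /(congr1 (Uexp M (fun i => - a i)%R l)).
  by rewrite -!comp_lfunE invl !id_lfunE.
rewrite -[RHS](comp_lfun1r) -(lker0_compfV ker0) comp_lfunA invl.
by rewrite comp_lfun1l.
Qed.

(** The generators [e_j] and [f_j] shift weights by plus or minus a simple
    root, so the hypothesis makes [Uexp M w] commute with them; the highest weight vector
    then tells which scalar it is. *)
Lemma Uexp_scalar w l :
    (forall j, expi (pairing w (simple_root R j)) = 1) ->
  forall u : M l, Uexp M w l u = expi (pairing w (weight_of R l)) *: u.
Proof.
move=> root1; have [v [v0 wv _]] := irrep_highest (M l).
apply: (eigenspace_eq_fullv (irrep_irreducible (M l)) _ v0 (UexpP hq w wv)).
move=> j; split; apply: eq_on_weight_vectors => mu u wu;
  rewrite !comp_lfunE /= (UexpP hq w wu) endZ.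
- rewrite (UexpP hq w (has_weight_e hq j wu)).
  by rewrite (pairingDr w mu (simple_root R j)) expiD root1 mulr1.
- rewrite (UexpP hq w (has_weight_f hq j wu)).
  rewrite (pairingDr w mu (fun i => - simple_root R j i)) pairingNr expiD.
  by rewrite -[expi (- _)]mul1r -(root1 j) -expiD subrr expi0 mulr1.
- by rewrite wu endZ (UexpP hq w wu) !scalerA mulrC.
- by rewrite (has_weight_kV hq j wu) endZ (UexpP hq w wu) !scalerA mulrC.
Qed.

(** A central element acts by one scalar on [M l]; comparing its values on a
    highest weight vector and on the same vector lowered by a simple root shows
    that the root takes the value 1.  The converse is [Uexp_scalar]. *)
Lemma central_Uexp w :
  central (Uexp M w) <-> forall j, expi (pairing w (simple_root R j)) = 1.
Proof.
split=> [cw j|root1 y]; last first.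
  apply/functional_extensionality_dep => l; apply/lfunP => u.
  by rewrite !comp_lfunE /= !(Uexp_scalar root1) endZ.
(* The weight rho takes the value 1 on both coroots, so both [f_0] and [f_1]
   are nonzero on its highest weight vector. *)
pose rho : dominant := [ffun=> 1%N].
have [v hv] := irrep_highest (M rho); have [_ wv _] := hv.
have fv0 : rep_f (M rho) j v != 0.
  by apply: (lowering_neq0 hq hv); rewrite /weight_of ffunE oner_neq0.
have := cw (fun l => rep_f (M l) j).
move/(congr1 (fun z : UG M => z rho v)); rewrite !comp_lfunE /=.
rewrite (UexpP hq w (has_weight_f hq j wv)) (UexpP hq w wv) endZ.
rewrite (pairingDr w _ (fun i => - simple_root R j i)) expiD mulrC -scalerA.
have sfv0 : expi (pairing w (weight_of R rho)) *: rep_f (M rho) j v != 0.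
  by rewrite scaler_eq0 negb_or expi_neq0.
move/(expi_fixes sfv0); rewrite pairingNr => root1.
by rewrite -[LHS]mulr1 -root1 -expiD subrr expi0.
Qed.

(** Since [M l] has integral highest weight and its other weights differ from it
    by roots, the kernel of [w |-> e^{2 pi i (w_0 h_1 + w_1 h_2)}] contains
    [Z^2]; the fundamental weights show that it is no larger. *)
Lemma Uexp_eq1 w : (forall i, w i \is a Num.int) <->
  Uexp M (fun i => pi *+ 2 * w i) = U1 M.
Proof.
split=> [wZ|w1 i].
  apply/functional_extensionality_dep => l; apply/lfunP => u.
  rewrite Uexp_scalar => [|j]; rewrite pairingZl.
    have /expi_eq1 -> : pairing w (weight_of R l) \is a Num.int.
      by rewrite pairingE !(rpredD, rpredM) ?wZ /weight_of ?natr_int.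
    by rewrite scale1r id_lfunE.
  apply/expi_eq1.
  have cartanZ k : simple_root R j k \is a Num.int.
    rewrite /simple_root /cartan; case: ifP => _;
      by rewrite ?natr_int ?rpredN ?rpred1.
  by rewrite pairingE !(rpredD, rpredM).
(* At the highest weight of the i-th fundamental representation, [w] pairs to
   [w i]. *)
pose l : dominant := [ffun j => (j == i) : nat].
have [v [v0 wv _]] := irrep_highest (M l).
have := UexpP hq (fun i => pi *+ 2 * w i) wv.
rewrite w1 id_lfunE => /esym/(expi_fixes v0).
rewrite pairingZl => /expi_eq1.
suff -> : pairing w (weight_of R l) = w i by [].
rewrite /pairing (bigD1 i) //= /weight_of ffunE eqxx mulr1.
by rewrite big1 ?addr0 // => j /negPf ji; rewrite ffunE ji mulr0.
Qed.

(** * Classes in the quotient of pairs of torus elements *)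

Lemma UT_Uexp a : UT (Uexp M a).
Proof. by exists a. Qed.

Lemma Uexp_mulV a : Umul (Uexp M a) (Uinv (Uexp M a)) = U1 M.
Proof. by rewrite UexpV UexpD -Uexp0; apply: eq_Uexp => i; rewrite subrr. Qed.

Lemma central_U1 : central (U1 M).
Proof. by move=> x; rewrite Umul1 mul1U. Qed.

Lemma UT_class_refl s1 s2 : UT s1 -> UT s2 -> UT_class s1 s2 (s1, s2).
Proof.
move=> Ts1 Ts2; split=> //; exists (U1 M); split; rewrite -?Uexp0 /=.
- exact: UT_Uexp.
- by rewrite Uexp0; exact: central_U1.
- by rewrite Uexp0 Umul1.
- rewrite UexpV (@eq_Uexp (fun=> - 0) (fun=> 0)) => [|i]; last exact: oppr0.
  by rewrite Uexp0 mul1U.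
Qed.

Lemma UT_class_shift_sub a b w : central (Uexp M w) ->
  UT_class (Uexp M (fun i => a i + w i)) (Uexp M (fun i => b i - w i)) `<=`
  UT_class (Uexp M a) (Uexp M b).
Proof.
move=> cw [t1 t2] [/= Tt1 Tt2 [_ [[u _ <-] cu /= -> ->]]]; split => //=.
- by rewrite UexpD; apply: UT_Uexp.
- by rewrite UexpV UexpD; apply: UT_Uexp.
exists (Uexp M (fun i => w i + u i)); split=> /=; first exact: UT_Uexp.
- by move=> x; rewrite -UexpD -UmulA cu UmulA cw -UmulA.
- by rewrite !UexpD; apply: eq_Uexp => i; rewrite addrA.
- by rewrite !UexpV !UexpD; apply: eq_Uexp => i; ring.
Qed.

Lemma UT_class_shift a b w : central (Uexp M w) ->
  UT_class (Uexp M (fun i => a i + w i)) (Uexp M (fun i => b i - w i)) =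
  UT_class (Uexp M a) (Uexp M b).
Proof.
move=> cw; apply/seteqP; split; first exact: UT_class_shift_sub.
(* The reverse inclusion is the first one for the shift by [- w]. *)
rewrite (@eq_Uexp a (fun i => (a i + w i) + - w i)) => [|i]; last first.
  by rewrite addrK.
rewrite (@eq_Uexp b (fun i => (b i - w i) - - w i)) => [|i]; last first.
  by ring.
apply: UT_class_shift_sub; apply/central_Uexp => j.
rewrite pairingNl; have /central_Uexp/(_ j) w1 := cw.
by rewrite -[LHS]mul1r -{1}w1 -expiD subrr expi0.
Qed.

(** Two-sided translation is well defined on classes: the central ambiguity
    [mu] on the left cancels [mu^-1] on the right across the argument. *)
Lemma UT_class_translation s1 s2 t1 t2 (f : functional M) :
  UT_class s1 s2 (t1, t2) -> lq t1 (dq t2 f) = lq s1 (dq s2 f).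
Proof.
move=> [_ _ [_ [[w _ <-] cw /= -> ->]]].
apply/funext => x; rewrite /lq /dq; congr f.
rewrite -!UmulA; congr Umul.
by rewrite UmulA cw -UmulA [Umul (Uexp _ _) _]UmulA Uexp_mulV mul1U.
Qed.

(** * Periodicity of the assignment *)

Variable y : 'I_2 -> 'I_2 -> R.

Lemma assigned_classE phi : assigned_class y phi =
  UT_class (Uexp M (fun j => phi * y 0 j)) (Uexp M (fun j => phi * y 1 j)).
Proof.
have split_h (a : 'I_2) :
    Umul (Uexph M 0 (phi * y a 0)) (Uexph M 1 (phi * y a 1)) =
    Uexp M (fun j => phi * y a j).
  rewrite UexpD; apply: eq_Uexp => -[[|[|//]] ltb]; rewrite /= ?addr0 ?add0r;
    by congr (_ * y a _); apply/val_inj.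
by rewrite /assigned_class !split_h.
Qed.

(** [(y 0 0, y 0 1)] is a coweight of su_3 and is opposite to
    [(y 1 0, y 1 1)] modulo coroots. *)
Definition periodicity_condition :=
  [/\ 2 * y 0 0 - y 0 1 \is a Num.int, 2 * y 0 1 - y 0 0 \is a Num.int,
      y 0 0 + y 1 0 \is a Num.int & y 0 1 + y 1 1 \is a Num.int].

Lemma central_Uexp_2pi w : central (Uexp M (fun i => pi *+ 2 * w i)) <->
  2 * w 0 - w 1 \is a Num.int /\ 2 * w 1 - w 0 \is a Num.int.
Proof.
rewrite -pairing_simple_root0 -pairing_simple_root1.
split=> [/central_Uexp h|[h0 h1]].
  by split; apply/expi_eq1; rewrite -pairingZl; apply: h.
by apply/central_Uexp; apply: ord2P; rewrite pairingZl; apply/expi_eq1.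
Qed.

(** The pair of units belongs to the class at [2 pi], hence differs from the
    pair of values at [2 pi] by some central
    [e^{2 pi i (w_0 h_1 + w_1 h_2)}];
    each of the three resulting conditions is read off by [Uexp_eq1] or
    [central_Uexp_2pi], and [w] is then eliminated. *)
Lemma periodicity_of_classes :
  assigned_class (M := M) y (pi *+ 2) = assigned_class y 0 ->
  periodicity_condition.
Proof.
rewrite !assigned_classE => /esym class_eq.
have := UT_class_refl (UT_Uexp (fun j => 0 * y 0 j))
                      (UT_Uexp (fun j => 0 * y 1 j)).
rewrite class_eq => -[_ _ [_ [[w0 _ <-] cw /=]]].
pose w i := w0 i / (pi *+ 2).
have pi2 : pi *+ 2 != 0 :> R by rewrite gt_eqF // pmulrn_lgt0 // pi_gt0.
move: cw; rewrite (@eq_Uexp w0 (fun i => pi *+ 2 * w i)); last first.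
  by move=> i; rewrite /w mulrC divfK.
move=> /central_Uexp_2pi[r0 r1].
have zero (a : 'I_2) : Uexp M (fun j => 0 * y a j) = U1 M.
  by rewrite -Uexp0; apply: eq_Uexp => j; rewrite mul0r.
rewrite UexpV !UexpD !zero => /esym e1 /esym e2.
have /Uexp_eq1 h1 : Uexp M (fun i => pi *+ 2 * (y 0 i + w i)) = U1 M.
  by rewrite -e1; apply: eq_Uexp => i; rewrite mulrDr.
have /Uexp_eq1 h2 : Uexp M (fun i => pi *+ 2 * (y 1 i - w i)) = U1 M.
  by rewrite -e2; apply: eq_Uexp => i; ring.
have opp i : y 0 i + y 1 i \is a Num.int.
  have -> : y 0 i + y 1 i = (y 0 i + w i) + (y 1 i - w i) by ring.
  by rewrite rpredD.
have root (i j : 'I_2) : 2 * w i - w j \is a Num.int ->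
    2 * y 0 i - y 0 j \is a Num.int.
  have -> : 2 * y 0 i - y 0 j =
      2 * (y 0 i + w i) - (y 0 j + w j) - (2 * w i - w j) by ring.
  move=> h; apply: rpredB h; apply: rpredB (h1 j).
  exact: rpredM (rpred_nat _ _) (h1 i).
by split; rewrite ?opp ?root.
Qed.

(** Going around the circle [m] times multiplies the representatives by
    [mu = e^{2 pi i m (y_00 h_1 + y_01 h_2)}], which is central, and by
    [e^{2 pi i m (y_10 h_1 + y_11 h_2)}], which equals [mu^-1]. *)
Lemma classes_periodic phi psi : periodicity_condition ->
  expi phi = expi psi -> assigned_class (M := M) y phi = assigned_class y psi.
Proof.
move=> [root0 root1 opp0 opp1] eqe.
have pi2 : pi *+ 2 != 0 :> R by rewrite gt_eqF // pmulrn_lgt0 // pi_gt0.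
have [m phiE] : exists m : int, phi = psi + pi *+ 2 * m%:~R.
  have : expi (pi *+ 2 * ((phi - psi) / (pi *+ 2))) = 1.
    by rewrite mulrC divfK // expiD eqe -expiD subrr expi0.
  move/expi_eq1/intrP => [m mE]; exists m.
  by rewrite -mE mulrC divfK //; ring.
pose w i := m%:~R * y 0 i.
have cw : central (Uexp M (fun i => pi *+ 2 * w i)).
  by apply/central_Uexp_2pi; split; rewrite /w mulrCA -mulrBr rpredM ?intr_int.
rewrite !assigned_classE -[RHS](UT_class_shift _ _ cw); congr UT_class.
  by apply: eq_Uexp => i; rewrite phiE /w; ring.
have opp : forall i, m%:~R * (y 0 i + y 1 i) \is a Num.int.
  by apply: ord2P; rewrite rpredM ?intr_int.
rewrite -[RHS]Umul1 -(iffLR (Uexp_eq1 _) opp) UexpD.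
by apply: eq_Uexp => i; rewrite phiE /w; ring.
Qed.

(** * The resulting action *)

Lemma CG_translate a b (f : functional M) :
  CG f -> CG (lq (Uexp M a) (dq (Uexp M b) f)).
Proof.
move=> [s ->].
exists [seq Tagged (fun l => 'Hom(M l, R[i]^o) * M l)%type
   ((tagged c).1 \o Uexp M a (tag c), Uexp M b (tag c) (tagged c).2)%VF
   | c <- s].
apply/funext => x; rewrite /lq /dq big_map; apply: eq_bigr => c _ /=.
by rewrite /matrix_coef /Umul !comp_lfunE.
Qed.

(** Choose an angle for each point of the circle and translate by the
    representatives at that angle.  Periodicity makes the choice immaterial, so
    multiplicativity can be checked with the sum of the chosen angles. *)
Lemma orbifold_of_periodicity (K1 : set R[i]) :
  closed_circle_subgroup K1 -> periodicity_condition ->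
  defines_quantum_orbifold M K1 y.
Proof.
move=> [K1norm K1_1 K1M _ _] per.
pose arg (z : R[i]) : R := xget 0 [set phi | expi phi = z].
have argK z : K1 z -> expi (arg z) = z.
  move=> /K1norm/expi_surj[phi hphi].
  by apply: (xgetPex 0 (P := [set phi | expi phi = z])); exists phi.
pose T (a : 'I_2) phi := Uexp M (fun j => phi * y a j).
have TD (a : 'I_2) phi psi : T a (phi + psi) = Umul (T a phi) (T a psi).
  by rewrite /T UexpD; apply: eq_Uexp => j; rewrite mulrDl.
pose act phi (f : functional M) := lq (T 0 phi) (dq (T 1 phi) f).
have act_per phi psi f : expi phi = expi psi -> act phi f = act psi f.
  move=> e; apply: UT_class_translation.
  rewrite -/(T 0 phi) -(assigned_classE psi) -(classes_periodic per e).
  by rewrite assigned_classE; apply: UT_class_refl; apply: UT_Uexp.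
exists (fun z => assigned_class y (arg z.1)), (fun z => act (arg z.1)).
split=> [phi K1phi|]; first by apply: classes_periodic per _; exact: argK.
split=> [s _|s f s1 s2 _ _|].
- rewrite assigned_classE.
  by eexists; eexists; split; last reflexivity; apply: UT_Uexp.
- by rewrite assigned_classE => /UT_class_translation.
split=> [s f _|//|f _|].
- exact: CG_translate.
- rewrite (act_per _ 0).
    rewrite /act /T; apply/funext => x; rewrite /lq /dq; congr f.
    have zero (a : 'I_2) : Uexp M (fun j => 0 * y a j) = U1 M.
      by rewrite -Uexp0; apply: eq_Uexp => j; rewrite mul0r.
    by rewrite !zero Umul1 mul1U.
  by rewrite argK // expi0.
move=> s s' f [K1s _] [K1s' _] _.
(* The factors coming from [s'] end up outermost on both sides of the argument,
   so the sum of the angles is split in opposite orders on the two sides. *)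
rewrite (act_per _ (arg s'.1 + arg s.1)).
  rewrite /act TD [in T 1 _]addrC TD.
  apply/funext => x; rewrite /lq /dq; congr f.
  by rewrite -!UmulA.
by rewrite expiD !argK //; [rewrite mulrC | apply: K1M].
Qed.

End Torus.

(** * The coweight lattice of su_3 *)

(** Put [m = 2 y_00 - y_01] and [n = 2 y_01 - y_00], so that
    [3 y_00 = 2 m + n]; then [x] is the remainder of [2 m + n] modulo 3 and
    [k 0 0] the quotient, while [y_01 = 2 y_00 - m]. *)
Lemma periodicity_conditionP (R : realType) (y : 'I_2 -> 'I_2 -> R) :
  periodicity_condition y <->
  exists (x : 'I_3) (k : 'I_2 -> 'I_2 -> int),
    [/\ y 0 0 = (k 0 0)%:~R + x%:R / 3,
        y 0 1 = (k 0 1)%:~R + 2 * x%:R / 3,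
        y 1 0 = (k 1 0)%:~R + 2 * x%:R / 3 &
        y 1 1 = (k 1 1)%:~R + x%:R / 3].
Proof.
split; last first.
  move=> [x [k [y00 y01 y10 y11]]]; split; apply/intrP.
  - exists (2%:Z * k 0 0 - k 0 1).
    by rewrite y00 y01 intrB intrM; field.
  - exists (2%:Z * k 0 1 - k 0 0 + x%:Z).
    by rewrite y00 y01 intrD intrB intrM; field.
  - exists (k 0 0 + k 1 0 + x%:Z).
    by rewrite y00 y10 !intrD; field.
  - exists (k 0 1 + k 1 1 + x%:Z).
    by rewrite y01 y11 !intrD; field.
move=> [/intrP[m mE] /intrP[n nE] /intrP[p pE] /intrP[r rE]].
pose d := ((2%:Z * m + n) %/ 3%:Z)%Z; pose e := ((2%:Z * m + n) %% 3%:Z)%Z.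
have dE : 2%:Z * m + n = d * 3%:Z + e by apply: divz_eq.
have e0 : 0 <= e by apply: modz_ge0.
have e3 : (`|e| < 3)%N by rewrite -ltz_nat gez0_abs // ltz_pmod.
pose x : 'I_3 := Ordinal e3.
have xE : (x%:R : R) = e%:~R by rewrite -[e in RHS]gez0_abs // -pmulrn.
have /(congr1 (fun z : int => z%:~R : R)) := dE.
rewrite !(intrD, intrM) => dER.
exists x, (fun a b => if a == 0 then if b == 0 then d else 2%:Z * d - m
  else if b == 0 then p - d - e else r - 2%:Z * d + m - e).
by rewrite /= xE !(intrB, intrD, intrM); split; lra.
Qed.

(* [y a b] is y_(a+1)^(b+1); likewise for [k]. *)
Theorem proposition5 (R : realType) (q : R) (hq : 0 < q < 1)
    (M : forall l : dominant, hw_irrep q l)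
    (K1 : set R[i]) (hK1 : closed_circle_subgroup K1)
    (y : 'I_2 -> 'I_2 -> R) :
  defines_quantum_orbifold M K1 y <->
  exists (x : 'I_3) (k : 'I_2 -> 'I_2 -> int),
    [/\ y 0 0 = (k 0 0)%:~R + x%:R / 3,
        y 0 1 = (k 0 1)%:~R + 2 * x%:R / 3,
        y 1 0 = (k 1 0)%:~R + 2 * x%:R / 3 &
        y 1 1 = (k 1 1)%:~R + x%:R / 3].
Proof.
rewrite -periodicity_conditionP; split=> [[cl [Th [clE _]]]|].
  (* The angles 0 and [2 pi] name the same point 1 of [K1]. *)
  apply: (periodicity_of_classes hq (M := M)).
  have turn : expi (pi *+ 2) = 1 :> R[i] by rewrite /expi cos2pi sin2pi.
  have K1_1 := circle_1 hK1.
  by rewrite -!clE ?turn ?expi0.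
by apply: (orbifold_of_periodicity hq).
Qed.
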